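(* For every $n\ge2$ let $\nu_n$ be a probability measure on $\{1,\dots,n\}$ with $\nu_n(i)>0$ for all $i$ and $\nu_n(i)>\nu_n(i+1)$ for all $1\le i\le n-1$, and let $i_0=i_0(n)\in\{1,\dots,n-1\}$. Let $\varepsilon=\varepsilon(n)>0$ and define $$L_i:=1+\varepsilon\ell_i,\qquad \ell_i:=\begin{cases}-\frac{1}{\sqrt{\nu_n(i)}}, & i<i_0,\\ 0,& i=i_0,\\ \frac{1}{\sqrt{\nu_n(1)}},& i=i_0+1,\\ \frac{1}{\sqrt{\nu_n(1)}}+\frac{1}{\sqrt{\nu_n(i)}},& i>i_0+1,\end{cases}$$ where $L_i>0$ for all $i$. Let $\alpha\in\mathbb{R}$ and let $k=k(n)>0$ be such that $k(n)^2$ is an eigenvalue of the operator $\Delta_L$ on the quantum star graph with edge lengths $L=(L_1,\dots,L_n)$ and coupling parameter $\alpha$, and $k(n)\to\infty$ as $n\to\infty$. Suppose that there are integers $m=m(n)\ge1$ such that, with $p_{m,i}:=m\pi/L_i$, one has $p_{m,i_0+1}<k<p_{m,i_0}$, and that the spectral repulsion condition holds at $i_0$: there is $\delta\in(0,\frac12]$, independent of $n$, with $$\frac{\min_{i\in\{i_0,i_0+1\}}|k-p_{m,i}|}{|p_{m,i_0}-p_{m,i_0+1}|}\ge\delta\qquad\text{for all }n.$$ Suppose moreover that we are in the clustering regime $m\,\varepsilon\,\|\ell\|\to0$ as $n\to\infty$, where $\|\ell\|=\max_i|\ell_i|$. Then there is a constant $C\ge1$ independent of $n$ such that, for all sufficiently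 large $n$ and all $i\in\{1,\dots,n\}\setminus\{i_0,i_0+1\}$, $$C^{-1}\nu_n(i)\le\mu_n^{k}(i)\le C\,\nu_n(i),$$ where $\mu_n^k$ is the mass measure of an eigenfunction of $\Delta_L$ with eigenvalue $k(n)^2$. In particular, the sequences $(\nu_n)_n$ and $(\mu_n^{k})_n$ have the same mass exponent.
   Context: Quantum star graph: given $L=(L_1,\dots,L_n)\in(0,\infty)^n$, take $n$ intervals $[0,L_i]$ glued together at the endpoints $L_i$, which form the central vertex $v$; the endpoints $0$ are the exterior vertices. For $\alpha\in\mathbb{R}$, the operator $\Delta_L$ acts as $-d^2/dx^2$ on each edge, on functions $\varphi=(\varphi_i)_{1\le i\le n}\in\bigoplus_i H^2([0,L_i])$ satisfying: $\varphi_i(L_i)=\varphi_j(L_j)=:\varphi(v)$ for all $i,j$ (continuity at $v$); $\varphi_i(0)=0$ for all $i$ (Dirichlet condition); and $\sum_{i=1}^n\varphi_i'(L_i)=\alpha\,\varphi(v)$ ($\delta$-type condition with coupling parameter $\alpha$). This is a self-adjoint operator with discrete spectrum. Mass measures: an eigenfunction $\varphi^{\langle k\rangle}$ with eigenvalue $k^2$, $k>0$, has the form $\varphi^{\langle k\rangle}_i(x)=\alpha_i\sin kx$ on the $i$-th edge. Normalize it so that $\sum_{i=1}^n|\alpha_i|^2=1$. The associated mass measure is the probability measure on $\{1,\dots,n\}$ given by $\mu_n^k(i)=|\alpha_i|^2$. Mass exponent: for a sequence of probability measures $\mu_n$ on $\{1,\dots,n\}$, the mass exponent is $\tau(q)=\limsup_{n\to\infty}\frac{\log\sum_{i=1}^n\mu_n(i)^q}{\log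 n}$, $q\ge1$. *)

(* Defs.v *)
From HB Require Import structures.
From mathcomp Require Import all_boot all_order all_algebra.
From mathcomp Require Import all_classical all_reals all_analysis.
From mathcomp.real_closed Require Import complex.
Import Order.TTheory GRing.Theory Num.Theory.
Import numFieldNormedType.Exports.

Set Implicit Arguments.
Unset Strict Implicit.
Unset Printing Implicit Defensive.

Local Open Scope classical_set_scope.
Local Open Scope ring_scope.
Local Open Scope complex_scope.

(* Functions on {1, ..., n} are represented by functions on [nat], of which
   only the values at 1 <= i <= n are used.  Likewise a function on the edge
   [0, L] is a function on R, of which only the values on [0, L] are used. *)

(* F is absolutely continuous on [0, L] with almost everywhere derivative f. *)
Definition primitive_on (R : realType) (L : R) (F f : R -> R) : Prop :=
  lebesgue_measure.-integrable `[0, L] (EFin \o f) /\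
  forall x, x \in `[0, L] ->
    F x = F 0 + \int[lebesgue_measure]_(t in `[0, x]) f t.

(* f is the C^1 representative of an element of the Sobolev space H^2([0, L]),
   with (continuous) derivative f1 and weak second derivative f2 : in dimension
   one, this means that f and f1 are absolutely continuous and f2 is in L^2
   (f and f1 are then continuous on [0, L], hence also in L^2).  Since f1 is
   the continuous derivative, its values at 0 and L are the (one-sided)
   derivatives of f there. *)
Definition sobolevH2 (R : realType) (L : R) (f f1 f2 : R -> R) : Prop :=
  [/\ primitive_on L f f1, primitive_on L f1 f2
    & (f2 \_ `[0, L]) \in Lfun lebesgue_measure 2%:E].

Definition sobolevH2C (R : realType) (L : R) (f f1 f2 : R -> R[i]) : Prop :=
  sobolevH2 L (@complex.Re R \o f) (@complex.Re R \o f1) (@complex.Re R \o f2)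
  /\
  sobolevH2 L (@complex.Im R \o f) (@complex.Im R \o f1) (@complex.Im R \o f2).

(* The graph of the operator Delta_L : phi is in its domain, and Delta_L phi is
   psi as an element of the direct sum of the L^2([0, L_i]).  Here v is the
   common value of phi at the central vertex. *)
Definition star_laplacian (R : realType) (n : nat) (L : nat -> R) (alpha : R)
    (phi psi : nat -> R -> R[i]) : Prop :=
  exists (phi1 phi2 : nat -> R -> R[i]) (v : R[i]),
    (forall i, (1 <= i <= n)%N ->
      [/\ sobolevH2C (L i) (phi i) (phi1 i) (phi2 i),
          phi i 0 = 0,
          phi i (L i) = v
        & {ae lebesgue_measure, forall x : R,
             x \in `[0, L i] -> psi i x = - phi2 i x}]) /\
    \sum_(1 <= i < n.+1) phi1 i (L i) = alpha%:C * v.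

Definition star_eigenfunction (R : realType) (n : nat) (L : nat -> R)
    (alpha lambda : R) (phi : nat -> R -> R[i]) : Prop :=
  star_laplacian n L alpha phi (fun i x => lambda%:C * phi i x) /\
  exists i x, [/\ (1 <= i <= n)%N, x \in `[0, L i] & phi i x != 0].

Definition star_eigenvalue (R : realType) (n : nat) (L : nat -> R)
    (alpha lambda : R) : Prop :=
  exists phi, star_eigenfunction n L alpha lambda phi.

(* The coefficient a such that f x = a sin(kx) on [0, L]; it is unique when
   k, L > 0, and exists for the components of an eigenfunction of Delta_L with
   eigenvalue k^2. *)
Definition edge_amplitude (R : realType) (k L : R) (f : R -> R[i]) : R[i] :=
  xget 0 [set a : R[i] | forall x, x \in `[0, L] -> f x = a * (sin (k * x))%:C].

(* Dividing by the sum amounts to normalizing the eigenfunction phi so that the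
   squared moduli of its amplitudes add up to 1. *)
Definition mass_measure (R : realType) (n : nat) (L : nat -> R) (k : R)
    (phi : nat -> R -> R[i]) (i : nat) : R :=
  let w j := ComplexField.Normc.normc (edge_amplitude k (L j) (phi j)) ^+ 2 in
  w i / \sum_(1 <= j < n.+1) w j.

Definition mass_exponent (R : realType) (mu : nat -> nat -> R) (q : R) : \bar R :=
  limn_esup (fun n =>
    (ln (\sum_(1 <= i < n.+1) mu n i `^ q) / ln n%:R)%:E).

Definition is_probability (R : realType) (n : nat) (nu : nat -> R) : Prop :=
  (forall i, (1 <= i <= n)%N -> 0 <= nu i) /\ \sum_(1 <= i < n.+1) nu i = 1.

Definition edge_ell (R : realType) (nu : nat -> R) (i0 i : nat) : R :=
  if (i < i0)%N then - (1 / Num.sqrt (nu i))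
  else if i == i0 then 0
  else if i == i0.+1 then 1 / Num.sqrt (nu 1)
  else 1 / Num.sqrt (nu 1) + 1 / Num.sqrt (nu i).

Definition edge_length (R : realType) (nu : nat -> R) (i0 : nat) (eps : R)
    (i : nat) : R :=
  1 + eps * edge_ell nu i0 i.

Definition sup_norm (R : realType) (n : nat) (l : nat -> R) : R :=
  \big[Num.max/0]_(1 <= i < n.+1) `|l i|.

(* Main.v *)
Require Import Defs.
From HB Require Import structures.
From mathcomp Require Import all_boot all_order all_algebra.
From mathcomp Require Import all_classical all_reals all_analysis.
From mathcomp.real_closed Require Import complex.
From mathcomp Require Import ring lra zify.
Import Order.TTheory GRing.Theory Num.Theory.
Import numFieldNormedType.Exports.

(* On each edge an eigenfunction is a_i sin(kx), and continuity at the centre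
   gives |a_i|^2 = |v|^2 / sin^2(k L_i), where the sines will not vanish.  Put
   x_i = k L_i - m pi.  Since k lies between the resonances of the edges i0 and
   i0 + 1, of lengths 1 and 1 + eps / sqrt(nu(1)), both |x_i0| and |x_(i0+1)|
   are at most k eps / sqrt(nu(1)), and by spectral repulsion at least
   delta / 2 times that.  For the other edges the offset ell_i adds to this
   phase with the same sign, and it dominates since nu(i) <= nu(1), so |x_i| is
   of the order of k eps / sqrt(nu(i)).  Clustering makes all these phases
   small, so sin^2(k L_i) is comparable with x_i^2, and |a_i|^2 is
   proportional to nu(i), or to nu(1) for the two special edges, up to a
   bounded factor.  These weights have total mass between 1 and 3, so
   normalization costs only a further constant; two extra copies of nu(1)^q do
   not affect the mass exponent either. *)

Set Implicit Arguments.
Unset Strict Implicit.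

Local Open Scope classical_set_scope.
Local Open Scope ring_scope.

(** * The Dirichlet problem on one edge, for absolutely continuous functions *)

Section EdgeODE.
Variable R : realType.
Implicit Types (F f g : R -> R) (L x k : R).

Lemma primitive_on_continuous L F f :
  0 < L -> primitive_on L F f -> {within `[0, L], continuous F}.
Proof.
move=> L0 [intf FE].
apply: (@subspace_eq_continuous _ _ _
  (fun x => F 0 + parameterized_integral lebesgue_measure 0 x f)).
  by move=> x; rewrite inE /= => xL; rewrite -FE.
apply: within_continuousD.
  by apply: continuous_subspaceT => x; exact: cvg_cst.
exact: parameterized_integral_continuous (ltW L0) intf.
Qed.

Lemma primitive_on_is_derive L F f x :
  primitive_on L F f -> {within `[0, L], continuous f} ->
  x \in `]0, L[ -> is_derive x 1 F (f x).
Proof.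
move=> [intf FE] cf /[dup] x0L; rewrite in_itv /= => /andP[x0 xL].
have [dF FE'] := continuous_FTC1_closed xL intf x0
  (within_continuous_continuous (lt_trans x0 xL) cf x0L).
apply: (@near_eq_is_derive R R R
  (fun y => F 0 + \int[lebesgue_measure]_(t in `[0, y]) f t) F x 1).
  (* The integral formula for [F] holds only on the edge, so [y] is kept close enough to the
     interior point [x] to stay there. *)
  near=> y; rewrite -FE // in_itv /=; apply/andP; split; apply: ltW; near: y.
    exact: lt_nbhsr.
  exact: lt_nbhsl.
rewrite -[f x]add0r -FE' derive1E.
apply: (@is_deriveD R R R (cst (F 0))).
exact: DeriveDef.
Unshelve. all: by end_near. Qed.

(** The operator determines the weak second derivative only almost everywhere. This lemma lets it be
    replaced by the continuous function [- k ^+ 2 * f], after which [f1] is differentiable in the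
    classical sense. *)
Lemma primitive_on_ae L F f g :
  primitive_on L F f -> lebesgue_measure.-integrable `[0, L] (EFin \o g) ->
  {ae lebesgue_measure, forall x : R, x \in `[0, L] -> f x = g x} ->
  primitive_on L F g.
Proof.
move=> [intf FE] intg fg; split=> // x xL; rewrite FE //; congr (_ + _).
have sub : `[0, x] `<=` `[0, L].
  by apply: subset_itvl; rewrite bnd_simp; move: xL; rewrite in_itv /= => /andP[].
rewrite /Rintegral; congr fine; apply: ae_eq_integral => //.
- by apply: (@measurable_funS _ _ _ _ `[0, L]) => //; exact: measurable_int intf.
- by apply: (@measurable_funS _ _ _ _ `[0, L]) => //; exact: measurable_int intg.
- apply: filterS fg; first exact: (ae_filter_ringOfSetsType lebesgue_measure).
  by move=> t /= ft tx; rewrite ft //; exact: sub.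
Qed.

Lemma derive0_constant L F :
  (forall x, x \in `]0, L[ -> is_derive x 1 F 0) ->
  {within `[0, L], continuous F} ->
  forall x, x \in `[0, L] -> F x = F 0.
Proof.
move=> dF cF x; rewrite in_itv /= => /andP[x0 xL].
have [c _] : exists2 c, c \in `[0, x]%R & F x - F 0 = 0 * (x - 0).
  apply: (@MVT_segment _ _ (fun=> 0)) => //.
    move=> y; rewrite in_itv /= => /andP[y0 yx]; apply: dF.
    by rewrite in_itv /= y0 (lt_le_trans yx).
  by apply: continuous_subspaceW cF; apply: subset_itvl; rewrite bnd_simp.
by rewrite mul0r => /eqP; rewrite subr_eq0 => /eqP.
Qed.

Lemma within_continuousM (A : set R) f g :
  {within A, continuous f} -> {within A, continuous g} ->
  {within A, continuous (fun x => f x * g x)}.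
Proof. by move=> cf cg x; apply: cvgM; [exact: cf|exact: cg]. Qed.

(* Variation of constants: [f cos - f1 sin / k] and [f sin + f1 cos / k] (both
   at [k x]) have zero derivative, and [f] is recovered from them. *)
Lemma dirichlet_edge_solution k L f f1 :
  0 < k -> 0 < L ->
  primitive_on L f f1 -> primitive_on L f1 (fun x => - k ^+ 2 * f x) ->
  f 0 = 0 ->
  forall x, x \in `[0, L] -> f x = f1 0 / k * sin (k * x).
Proof.
move=> k0 L0 pf pf1 f0 x xL.
have cf := primitive_on_continuous L0 pf.
have cf1 := primitive_on_continuous L0 pf1.
have csin : continuous (fun y => sin (k * y)).
  move=> y; apply: continuous_comp; first exact: mulrl_continuous.
  exact: continuous_sin.
have ccos : continuous (fun y => cos (k * y)).
  move=> y; apply: continuous_comp; first exact: mulrl_continuous.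
  exact: continuous_cos.
have df y : y \in `]0, L[ -> is_derive y 1 f (f1 y).
  exact: primitive_on_is_derive.
have df1 y : y \in `]0, L[ -> is_derive y 1 f1 (- k ^+ 2 * f y).
  apply: (primitive_on_is_derive (f := fun x => - k ^+ 2 * f x)) => //.
  apply: (@within_continuousM _ (fun=> - k ^+ 2)) => //.
  by apply: continuous_subspaceT => z; exact: cvg_cst.
have dk (y : R) : is_derive y 1 (fun y => k * y) k.
  by apply: is_derive_eq; rewrite /GRing.scale /=; ring.
have dsin (y : R) : is_derive y 1 (fun y => sin (k * y)) (cos (k * y) * k).
  exact: is_derive1_comp.
have dcos (y : R) : is_derive y 1 (fun y => cos (k * y)) (- sin (k * y) * k).
  exact: is_derive1_comp.
pose A := f * (fun y => sin (k * y)) + f1 * (fun y => k^-1 * cos (k * y)).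
pose B := f * (fun y => cos (k * y)) + f1 * (fun y => - k^-1 * sin (k * y)).
have cAB (u v : R -> R) : continuous u -> continuous v ->
    {within `[0, L], continuous (f * u + f1 * v)}.
  move=> cu cv; apply: within_continuousD; apply: within_continuousM => //;
    exact: continuous_subspaceT.
have dA y : y \in `]0, L[ -> is_derive y 1 A 0.
  move=> yL; have dfy := df _ yL; have df1y := df1 _ yL.
  by apply: is_derive_eq; rewrite /GRing.scale /=; field; rewrite gt_eqF.
have dB y : y \in `]0, L[ -> is_derive y 1 B 0.
  move=> yL; have dfy := df _ yL; have df1y := df1 _ yL.
  by apply: is_derive_eq; rewrite /GRing.scale /=; field; rewrite gt_eqF.
have AE : A x = A 0.
  apply: (derive0_constant dA) => //.
  by apply: cAB => // y; apply: cvgM; [exact: cvg_cst|exact: ccos].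
have BE : B x = B 0.
  apply: (derive0_constant dB) => //.
  by apply: cAB => // y; apply: cvgM; [exact: cvg_cst|exact: csin].
transitivity (A x * sin (k * x) + B x * cos (k * x)).
  by rewrite -[LHS]mulr1 -(cos2Dsin2 (k * x)) /A /B !fctE; ring.
(* At the exterior vertex the Dirichlet condition gives [B 0 = 0] and [A 0 = f1 0 / k]. *)
by rewrite AE BE /A /B !fctE f0 mulr0 sin0 cos0
  !(mul0r, mulr0, add0r, mulr1, addr0).
Qed.

End EdgeODE.

(** * Amplitudes of eigenfunctions of the star graph *)

Section EdgeAmplitude.
Variable R : realType.
Implicit Types (f : R -> R) (k : R).

Lemma sobolevH2_edge_solution k (L : R) f f1 f2 :
  0 < k -> 0 < L -> sobolevH2 L f f1 f2 -> f 0 = 0 ->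
  {ae lebesgue_measure, forall x : R, x \in `[0, L] -> f2 x = - k ^+ 2 * f x} ->
  forall x, x \in `[0, L] -> f x = f1 0 / k * sin (k * x).
Proof.
move=> k0 L0 [pf pf1 _] f0 f2E.
apply: dirichlet_edge_solution => //; apply: primitive_on_ae pf1 _ f2E.
(* Integrability of the new second derivative comes from the continuity of [f] on the compact
   edge. *)
apply: continuous_compact_integrable; first exact: segment_compact.
apply: (@within_continuousM _ _ (fun=> - k ^+ 2)).
  by apply: continuous_subspaceT => z; exact: cvg_cst.
exact: primitive_on_continuous pf.
Qed.

Local Open Scope complex_scope.

(** As [k] is real, the equation decouples into its real and imaginary parts, and the two real
    amplitudes form the complex one. *)
Lemma sobolevH2C_edge_solution k (L : R) (f f1 f2 : R -> R[i]) :
  0 < k -> 0 < L -> sobolevH2C L f f1 f2 -> f 0 = 0 ->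
  {ae lebesgue_measure, forall x : R,
     x \in `[0, L] -> (k ^+ 2)%:C * f x = - f2 x} ->
  exists a : R[i], forall x, x \in `[0, L] -> f x = a * (sin (k * x))%:C.
Proof.
move=> k0 L0 [HRe HIm] f0 f2E.
have reE (c : R) (z : R[i]) : complex.Re (c%:C * z) = c * complex.Re z.
  by case: z => u v /=; rewrite mul0r subr0.
have imE (c : R) (z : R[i]) : complex.Im (c%:C * z) = c * complex.Im z.
  by case: z => u v /=; rewrite mul0r addr0.
have reN (z : R[i]) : complex.Re (- z) = - complex.Re z by case: z.
have imN (z : R[i]) : complex.Im (- z) = - complex.Im z by case: z.
have fRe := sobolevH2_edge_solution k0 L0 HRe.
have fIm := sobolevH2_edge_solution k0 L0 HIm.
exists ((complex.Re (f1 0) / k) +i* (complex.Im (f1 0) / k)) => x xL.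
rewrite mulrC; apply/eqP; rewrite eq_complex reE imE /=.
apply/andP; split; apply/eqP; rewrite mulrC.
  apply: fRe => //; first by rewrite /= f0.
  apply: filterS f2E; first exact: (ae_filter_ringOfSetsType lebesgue_measure).
  by move=> t /= ft tL; rewrite mulNr -reE ft // reN opprK.
apply: fIm => //; first by rewrite /= f0.
apply: filterS f2E; first exact: (ae_filter_ringOfSetsType lebesgue_measure).
by move=> t /= ft tL; rewrite mulNr -imE ft // imN opprK.
Qed.

(** The existence hypothesis excludes the default value [0] of [xget]. *)
Lemma edge_amplitudeP k (L : R) (f : R -> R[i]) :
  (exists a : R[i], forall x, x \in `[0, L] -> f x = a * (sin (k * x))%:C) ->
  forall x, x \in `[0, L] -> f x = edge_amplitude k L f * (sin (k * x))%:C.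
Proof. by move=> ha; exact: (xgetPex 0 ha). Qed.

(** [V] is the squared modulus of the value at the central vertex, which continuity makes common to
    all edges. *)
Lemma star_amplitudes n (L : nat -> R) (alpha k : R) (phi : nat -> R -> R[i]) :
  0 < k -> (forall i, (1 <= i <= n)%N -> 0 < L i) ->
  (forall i, (1 <= i <= n)%N -> sin (k * L i) != 0) ->
  star_eigenfunction n L alpha (k ^+ 2) phi ->
  exists2 V : R, 0 < V & forall i, (1 <= i <= n)%N ->
    ComplexField.Normc.normc (edge_amplitude k (L i) (phi i)) ^+ 2
    = V / sin (k * L i) ^+ 2.
Proof.
move=> k0 L0 sin0 [[phi1 [phi2 [v [H _]]]] [i [x [iP xL phix]]]].
have phiE j : (1 <= j <= n)%N -> forall y, y \in `[0, L j] ->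
    phi j y = edge_amplitude k (L j) (phi j) * (sin (k * y))%:C.
  move=> jP; apply: edge_amplitudeP; have [H2 phi0 _ ae2] := H _ jP.
  exact: sobolevH2C_edge_solution (L0 _ jP) H2 phi0 ae2.
have vE j : (1 <= j <= n)%N ->
    edge_amplitude k (L j) (phi j) * (sin (k * L j))%:C = v.
  move=> jP; have [_ _ <- _] := H _ jP; rewrite phiE //.
  by rewrite in_itv /= lexx ltW // L0.
(* If [v] were zero, the nonvanishing sine would force a zero amplitude on the edge where [phi] is
   nonzero. *)
have v0 : v != 0.
  apply: contra_neq phix => v0; rewrite phiE //; have /eqP := vE _ iP.
  rewrite v0 mulf_eq0 => /orP[/eqP ->|]; first by rewrite mul0r.
  by rewrite -(rmorph0 (real_complex R)) (inj_eq (@complexI _)) (negbTE (sin0 _ iP)).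
exists (ComplexField.Normc.normc v ^+ 2).
  rewrite exprn_gt0 // lt_neqAle; apply/andP; split; last first.
    by case: (v) => a b; rewrite /= sqrtr_ge0.
  rewrite eq_sym; apply: contra_neq v0; exact: ComplexField.Normc.eq0_normc.
move=> j jP; rewrite -(vE _ jP) ComplexField.Normc.normcM exprMn.
have -> : ComplexField.Normc.normc (sin (k * L j))%:C ^+ 2 = sin (k * L j) ^+ 2.
  by rewrite /= expr0n /= addr0 sqr_sqrtr // sqr_ge0.
by rewrite mulfK // expf_neq0 // sin0.
Qed.

End EdgeAmplitude.

(** * Elementary bounds for the sine near its zeros *)

Section SineBounds.
Variable R : realType.
Implicit Types x y : R.

Lemma sin_le_id x : 0 <= x -> sin x <= x.
Proof.
move=> x0.
have [c _] : exists2 c, c \in `[0, x]%R & sin x - sin 0 = cos c * (x - 0).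
  by apply: MVT_segment => //; apply: continuous_subspaceT; exact: continuous_sin.
rewrite sin0 !subr0 => ->; rewrite ler_piMl //; exact: cos_le1.
Qed.

(** The half-angle formula cos x = 1 - 2 sin^2(x/2) reduces this to sin(x/2) <= 1/2. *)
Lemma cos_ge_half x : 0 <= x <= 1 -> 1 / 2 <= cos x.
Proof.
move=> /andP[x0 x1].
have -> : x = (x / 2) *+ 2 by rewrite mulr2n; lra.
rewrite cos_mulr2n cos2sin2.
have h0 : 0 <= x / 2 by lra.
have h1 : sin (x / 2) <= 1 / 2 by apply: le_trans (sin_le_id h0) _; lra.
have h2 : 0 <= sin (x / 2).
  by apply: sin_ge0_pi; rewrite h0 (le_trans _ (pi_ge2 R)) //; lra.
have h3 : sin (x / 2) ^+ 2 <= 1 / 4 by nra.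
lra.
Qed.

Lemma sin_ge_half x : 0 <= x <= 1 -> x / 2 <= sin x.
Proof.
move=> /andP[x0 x1].
have [c] : exists2 c, c \in `[0, x]%R & sin x - sin 0 = cos c * (x - 0).
  by apply: MVT_segment => //; apply: continuous_subspaceT; exact: continuous_sin.
rewrite in_itv /= => /andP[c0 cx]; rewrite sin0 !subr0 => ->.
have : 1 / 2 <= cos c by apply: cos_ge_half; lra.
nra.
Qed.

Lemma sqr_sin_bounds x : `|x| <= 1 -> x ^+ 2 / 4 <= sin x ^+ 2 <= x ^+ 2.
Proof.
move=> x1.
have -> : sin x ^+ 2 = sin `|x| ^+ 2.
  by case: (ger0P x) => // _; rewrite sinN sqrrN.
rewrite -(real_normK (num_real x)).
have h1 := sin_le_id (normr_ge0 x).
have h2 : `|x| / 2 <= sin `|x| by apply: sin_ge_half; rewrite normr_ge0 x1.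
have h3 := normr_ge0 x; apply/andP; split; nra.
Qed.

(** The squared sine has period pi, so a phase can be measured from the nearby zero [m%:R * pi]. *)
Lemma sqr_sin_subMpi x (m : nat) : sin x ^+ 2 = sin (x - m%:R * pi) ^+ 2.
Proof.
elim: m => [|m IH]; first by rewrite mul0r subr0.
rewrite IH -[in LHS](subrK pi (x - m%:R * pi)) sinDpi sqrrN.
by congr (sin _ ^+ 2); rewrite mulrSr; ring.
Qed.

End SineBounds.

(** * Stability of upper limits under small perturbations *)

Section Limsup.
Variable R : realType.
Implicit Types u v : nat -> R.

Lemma le_limn_esup_near u v : (u n - v n @[n --> \oo] --> (0 : R)) ->
  (limn_esup (EFin \o u) <= limn_esup (EFin \o v))%E.
Proof.
move=> uv; apply: le_ereal_inf_tmp => _ [V Vinf <-].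
apply/lee_addgt0Pr => e e0.
have : \forall n \near \oo, u n <= v n + e.
  move/cvgrPdist_le : uv => /(_ _ e0); apply: filterS => n.
  by rewrite sub0r normrN => /ler_normlP[_]; rewrite lerBlDl.
(* The upper limit is an infimum of suprema over neighbourhoods of infinity. Each [V] used for [v]
   can be shrunk to [W], where [u] exceeds [v] by at most [e]. *)
move=> ule; pose W := V `&` [set n | u n <= v n + e].
apply: (@le_trans _ _ (ereal_sup ((EFin \o u) @` W))).
  apply: ereal_inf_lbound; exists W => //; exact: filterI.
apply: ge_ereal_sup => _ [n [Vn un] <-] /=.
apply: (@le_trans _ _ ((v n)%:E + e%:E)%E); first by rewrite -EFinD lee_fin.
by rewrite leeD2r //; apply: ereal_sup_ubound; exists n.
Qed.

Lemma eq_limn_esup_near u v : (u n - v n @[n --> \oo] --> (0 : R)) ->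
  limn_esup (EFin \o u) = limn_esup (EFin \o v).
Proof.
move=> uv; apply/eqP; rewrite eq_le !le_limn_esup_near //.
under eq_fun do rewrite -opprB; rewrite -oppr0; exact: cvgN.
Qed.

(* A bounded change of the logarithms disappears after division by [ln n]. *)
Lemma eq_limn_esup_ln_ratio u v (G : R) :
  (\forall n \near \oo, 0 < u n /\ G^-1 * u n <= v n <= G * u n) -> 0 < G ->
  limn_esup (fun n => (ln (u n) / ln n%:R)%:E) =
  limn_esup (fun n => (ln (v n) / ln n%:R)%:E).
Proof.
move=> uv G0; apply: (@eq_limn_esup_near (fun n => ln (u n) / ln n%:R)
  (fun n => ln (v n) / ln n%:R)).
apply/cvgrPdist_le => e e0.
(* Once [n] is at least [expR M], ln n is at least [M], hence |ln G| / ln n <= e. Adding 1 keeps [M]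
   positive when ln G = 0. *)
set M := `|ln G| / e + 1.
have M0 : 0 < M by rewrite ltr_wpDl // divr_ge0 // ltW.
have Me : `|ln G| <= e * M.
  by rewrite /M mulrDr mulrCA divff ?gt_eqF // !mulr1 lerDl ltW.
have : \forall n \near \oo, expR M <= n%:R :> R by exact: nbhs_infty_ger.
apply: filterS2 uv => n [u0 /andP[uv vu]] nM.
have n0 : 0 < n%:R :> R by apply: lt_le_trans nM; exact: expR_gt0.
have lnn : M <= ln n%:R by rewrite -(expRK M) ler_ln // posrE expR_gt0.
have v0 : 0 < v n by apply: lt_le_trans uv; rewrite mulr_gt0 // invr_gt0.
have h1 : ln (v n) <= ln G + ln (u n).
  by rewrite -lnM ?posrE // ler_ln ?posrE // mulr_gt0.
have h2 : ln (u n) - ln G <= ln (v n).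
  rewrite addrC -(lnV (x := G)) ?posrE // -lnM ?posrE ?invr_gt0 //.
  by rewrite ler_ln ?posrE // mulr_gt0 // invr_gt0.
rewrite sub0r normrN -mulrBl normrM normfV (gtr0_norm (lt_le_trans M0 lnn)).
rewrite ler_pdivrMr ?(lt_le_trans M0) //.
apply: (@le_trans _ _ `|ln G|); last first.
  by apply: le_trans Me _; rewrite ler_pM2l.
by apply: le_trans _ (ler_norm _); rewrite ler_norml; lra.
Qed.
End Limsup.

(** * Phases at the central vertex and the resulting mass bounds *)

Section Phases.
Local Open Scope complex_scope.
Variable R : realType.
Implicit Types (nu : nat -> R) (eps k delta : R).

(* [mu i] is comparable with [flat_weight nu i0 i] for every [i]: at the two
   edges whose resonances surround [k], the mass is of the order of [nu 1]. *)
Definition flat_weight nu i0 i : R :=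
  if (i == i0) || (i == i0.+1) then nu 1 else nu i.

Lemma edge_phase_bounds nu i0 eps k delta (m i : nat)
    (L := edge_length nu i0 eps)
    (p := fun j => m%:R * pi / L j)
    (r := 1 / Num.sqrt (flat_weight nu i0 i)) :
  0 < nu 1 -> 0 < nu i <= nu 1 ->
  0 < eps -> eps * (1 / Num.sqrt (nu 1)) <= 1 ->
  0 < k -> p i0.+1 < k < p i0 -> 0 < delta <= 1 / 2 ->
  delta <= Num.min `|k - p i0| `|k - p i0.+1| / `|p i0 - p i0.+1| ->
  delta / 2 * (k * eps * r) <= `|k * L i - m%:R * pi| <= 2 * (k * eps * r).
Proof.
move=> nu1 /andP[nui nui1] eps0 small k0 /andP[qk kp] /andP[d0 d12].
have Li0 : L i0 = 1 by rewrite /L /edge_length /edge_ell ltnn eqxx mulr0 addr0.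
set s := 1 / Num.sqrt (nu 1) in small *.
have Li1 : L i0.+1 = 1 + eps * s.
  by rewrite /L /edge_length /edge_ell ltnNge leqnSn /= gtn_eqF // eqxx.
have s0 : 0 < s by rewrite divr_gt0 // sqrtr_gt0.
have sri : s <= 1 / Num.sqrt (nu i).
  rewrite /s !div1r lef_pV2 ?posrE ?sqrtr_gt0 //.
  by rewrite ler_sqrt // ltW.
set P := m%:R * pi in p qk kp *.
move: qk kp; rewrite /p Li0 Li1 divr1 => qk kp.
set t := eps * s in small Li1 qk *.
have t0 : 0 < t by rewrite mulr_gt0.
(* [P] and [q] are the resonances of the edges [i0] and [i0.+1], whose lengths are 1 and [1 + t]. *)
set q := P / (1 + t) in qk *.
have Pq : P = q * (1 + t) by rewrite /q divfK // gt_eqF // addr_gt0.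
have q0 : k / 2 <= q by rewrite /q ler_pdivlMr ?addr_gt0 //; nra.
have Pq0 : 0 < P - q by nra.
rewrite (gtr0_norm Pq0) (ler_pdivlMr _ _ Pq0) le_min.
rewrite (ltr0_norm (_ : k - P < 0)) ?subr_lt0 //.
rewrite (gtr0_norm (_ : 0 < k - q)) ?subr_gt0 //.
move=> /andP[dP dq].
have Ks : k * eps * s = k * t by rewrite -mulrA.
(* The gap P - q equals q t, and t <= 1 gives q >= k/2. So the gap is at least k t / 2, which is the
   source of [delta / 2]. *)
have dKs : delta / 2 * (k * t) <= delta * (P - q).
  have : k / 2 * t <= P - q by rewrite Pq; nra.
  by move=> h; rewrite (_ : _ / 2 * _ = delta * (k / 2 * t)) ?ler_pM2l //; ring.
have PkKs : P - k <= k * t by nra.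
(* The right side, the phase at [i0.+1], is exactly (1 + t)(k - q). *)
have KsPq : k - q <= k * (1 + t) - P by rewrite [in leRHS]Pq; nra.
have kt0 : 0 < k * t by rewrite mulr_gt0.
have kss : k * t <= k * eps * (1 / Num.sqrt (nu i)).
  by rewrite -Ks ler_pM2l // mulr_gt0.
have dx (x : R) : 0 <= x -> delta / 2 * x <= x by move=> x0; nra.
have := dx (k * eps * (1 / Num.sqrt (nu i))).
rewrite /r /flat_weight.
have [->|ii0] /= := eqVneq i i0.
  by move=> _; rewrite Li0 mulr1 Ks ltr0_norm; lra.
have [->|ii1] /= := eqVneq i i0.+1.
  by move=> _; rewrite Li1 -/s Ks gtr0_norm; lra.
rewrite /L /edge_length /edge_ell (negbTE ii0) (negbTE ii1) -/s.
set r' := 1 / Num.sqrt (nu i) in sri kss *.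
move=> /(_ (le_trans (ltW kt0) kss)) dr.
(* On either side of the special edges the phase is the sum of two terms of equal sign. The offset
   term alone gives the lower bound; the other term is at most [k * t], itself bounded by the offset
   term, whence the factor 2. *)
case: ifP => ilt.
  rewrite (_ : k * _ - P = - (P - k + k * eps * r')); last by ring.
  by rewrite normrN gtr0_norm; lra.
rewrite (_ : k * _ - P = k * (1 + t) - P + k * eps * r'); last by rewrite /t; ring.
by rewrite gtr0_norm; lra.
Qed.

Lemma sup_norm_ge n (l : nat -> R) i : (1 <= i <= n)%N -> `|l i| <= sup_norm n l.
Proof.
by move=> iP; apply: (@le_bigmax_seq _ _ _ _ _ i xpredT); rewrite ?mem_index_iota.
Qed.

(** This turns the clustering condition into smallness of each phase. At the two special edges the
    bound is read off from [edge_ell] at [i0.+1]. *)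
Lemma inv_sqrt_flat_weight_le nu i0 n i : (forall j, (1 <= j <= n)%N -> 0 < nu j) ->
  (1 <= i0 <= n - 1)%N -> (1 <= i <= n)%N ->
  1 / Num.sqrt (flat_weight nu i0 i) <= sup_norm n (edge_ell nu i0).
Proof.
move=> nu0 i0P iP.
have r0 j : 0 <= 1 / Num.sqrt (nu j) by rewrite divr_ge0 // sqrtr_ge0.
(* The bound [i0 <= n - 1] ensures that the edge [i0.+1] exists. *)
have i01P : (1 <= i0.+1 <= n)%N by lia.
rewrite /flat_weight; case: ifPn => [_|].
  apply: le_trans (sup_norm_ge _ i01P).
  by rewrite /edge_ell ltnNge leqnSn /= gtn_eqF // eqxx ler_norm.
rewrite negb_or => /andP[/negbTE ii0 /negbTE ii1].
apply: le_trans (sup_norm_ge _ iP); rewrite /edge_ell ii0 ii1.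
case: ifP => _; first by rewrite normrN ler_norm.
by apply: le_trans (ler_norm _); rewrite lerDr.
Qed.

(** Flattening adds at most two copies of [F 1], each bounded by the whole sum. A general [F] is
    allowed so that the lemma applies both to [nu] and to its powers. *)
Lemma sum_flat_weight (F : nat -> R) n i0 :
  (1 <= n)%N -> (forall i, (1 <= i <= n)%N -> 0 <= F i <= F 1) ->
  \sum_(1 <= i < n.+1) F i <= \sum_(1 <= i < n.+1) flat_weight F i0 i
    <= 3 * \sum_(1 <= i < n.+1) F i.
Proof.
move=> n1 F0; have F1 : 0 <= F 1 by have /andP[] := F0 1 n1.
apply/andP; split.
  rewrite big_nat [leRHS]big_nat; apply: ler_sum => i /F0 /andP[? ?].
  by rewrite /flat_weight; case: ifP.
have F1S : F 1 <= \sum_(1 <= i < n.+1) F i.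
  rewrite big_ltn // lerDl big_nat sumr_ge0 // => i /andP[i2 iin].
  by have /andP[] := F0 i (introT andP (conj (ltnW i2) iin)).
have single j : \sum_(1 <= i < n.+1) (if i == j then F 1 else 0) <= F 1.
  by rewrite -big_mkcond big_nat1_eq; case: ifP.
apply: (@le_trans _ _ (\sum_(1 <= i < n.+1)
    (F i + ((if i == i0 then F 1 else 0) + (if i == i0.+1 then F 1 else 0))))).
  rewrite big_nat [leRHS]big_nat; apply: ler_sum => i /F0 /andP[Fi _].
  by rewrite /flat_weight; case: (i == i0); case: (i == i0.+1) => /=; lra.
rewrite !big_split /=; have := single i0; have := single i0.+1; lra.
Qed.

(** The total of [w] lies between [a] and [3 * b], so dividing by it changes the bounds [a] and [b]
    to a/(3b) and b/a. The single constant [3 * b / a] covers both. *)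
Lemma normalized_weight_bounds (w f : nat -> R) n (a b : R) :
  0 < a -> 0 < b -> (forall i, (1 <= i <= n)%N -> a * f i <= w i <= b * f i) ->
  (forall i, (1 <= i <= n)%N -> 0 <= f i) -> 1 <= \sum_(1 <= i < n.+1) f i <= 3 ->
  forall i, (1 <= i <= n)%N ->
    (3 * b / a)^-1 * f i <= w i / \sum_(1 <= j < n.+1) w j <= 3 * b / a * f i.
Proof.
move=> a0 b0 wf f0 /andP[S1 S3] i iP.
set S := \sum_(1 <= i < n.+1) f i in S1 S3.
have Sa : a <= \sum_(1 <= j < n.+1) w j.
  apply: (@le_trans _ _ (a * S)); first by rewrite ler_pMr.
  by rewrite /S mulr_sumr !big_nat; apply: ler_sum => j /wf /andP[].
have Sb : \sum_(1 <= j < n.+1) w j <= 3 * b.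
  apply: (@le_trans _ _ (b * S)); last by rewrite mulrC ler_pM2r.
  by rewrite /S mulr_sumr !big_nat; apply: ler_sum => j /wf /andP[].
have W0 := lt_le_trans a0 Sa.
have /andP[aw wb] := wf i iP; have fi := f0 i iP.
set W := \sum_(1 <= j < n.+1) w j in Sa Sb W0 *.
apply/andP; split.
  rewrite ler_pdivlMr //; apply: le_trans aw.
  rewrite (_ : _ * W = a * f i * (W / (3 * b))); last by field; rewrite !gt_eqF.
  by rewrite ler_piMr ?(mulr_ge0 (ltW a0)) // ler_pdivrMr ?mul1r // mulr_gt0.
rewrite ler_pdivrMr //; apply: (le_trans wb).
rewrite (_ : _ * W = b * f i * (3 * (W / a))); last by field; rewrite !gt_eqF.
rewrite ler_peMr ?(mulr_ge0 (ltW b0)) //.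
have : 1 <= W / a by rewrite ler_pdivlMr ?mul1r.
lra.
Qed.

Lemma mass_measure_bounds n nu i0 eps alpha k delta m (phi : nat -> R -> R[i])
    (L := edge_length nu i0 eps) (p := fun i => m%:R * pi / L i) :
  (2 <= n)%N -> is_probability n nu ->
  (forall i, (1 <= i <= n)%N -> 0 < nu i <= nu 1) ->
  (1 <= i0 <= n - 1)%N -> 0 < eps -> (forall i, (1 <= i <= n)%N -> 0 < L i) ->
  0 < k -> (1 <= m)%N -> p i0.+1 < k < p i0 -> 0 < delta <= 1 / 2 ->
  delta <= Num.min `|k - p i0| `|k - p i0.+1| / `|p i0 - p i0.+1| ->
  m%:R * eps * sup_norm n (edge_ell nu i0) <= 1 / 8 ->
  star_eigenfunction n L alpha (k ^+ 2) phi ->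
  forall i, (1 <= i <= n)%N ->
    (192 / delta ^+ 2)^-1 * flat_weight nu i0 i <= mass_measure n L k phi i
      <= 192 / delta ^+ 2 * flat_weight nu i0 i.
Proof.
move=> n2 [_ nuS] nu0 i0P eps0 L0 k0 m1 kp dP rep clus eig.
have f0 i : (1 <= i <= n)%N -> 0 < flat_weight nu i0 i.
  by move=> iP; rewrite /flat_weight; case: ifP => _;
    have /andP[h1 h2] := nu0 _ iP => //; exact: lt_le_trans h2.
have ell_le i : (1 <= i <= n)%N ->
    m%:R * (eps * (1 / Num.sqrt (flat_weight nu i0 i))) <= 1 / 8.
  move=> iP; apply: le_trans clus; rewrite -mulrA !ler_wpM2l ?(ltW eps0) //.
  by apply: inv_sqrt_flat_weight_le => // j /nu0 /andP[].
have i0n : (1 <= i0 <= n)%N by lia.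
(* This is the clustering bound at the edge [i0], where the flat weight is [nu 1], combined with
   [m >= 1]. *)
have small : eps * (1 / Num.sqrt (nu 1)) <= 1.
  have := ell_le _ i0n; rewrite /flat_weight eqxx /=; set t := eps * _ => mt.
  have t0 : 0 <= t by rewrite mulr_ge0 ?(ltW eps0) // divr_ge0 // sqrtr_ge0.
  have : t <= m%:R * t by rewrite ler_peMl // ler1n.
  lra.
(* The edge [i0] has length 1, so k < m pi, and pi < 4. *)
have kPi : k <= m%:R * 4.
  move: kp => /andP[_]; rewrite /p /L /edge_length /edge_ell ltnn eqxx mulr0 addr0 divr1.
  move=> /ltW /le_trans; apply; rewrite ler_wpM2l //.
  by have := @pihalf_lt2 R; rewrite ltr_pdivrMr // => /ltW; rewrite -natrM.
have d0 : 0 < delta by case/andP: dP.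
set K := k * eps; have K0 : 0 < K by rewrite mulr_gt0.
have nu1 : 0 < nu 1 by have /andP[] := nu0 1%N ltac:(lia).
have sinB i : (1 <= i <= n)%N ->
    (delta * K) ^+ 2 / 16 / flat_weight nu i0 i <= sin (k * L i) ^+ 2
      <= 4 * K ^+ 2 / flat_weight nu i0 i.
  move=> iP; rewrite (sqr_sin_subMpi _ m).
  set x := k * L i - m%:R * pi.
  have := edge_phase_bounds nu1 (nu0 _ iP) eps0 small k0 kp dP rep.
  rewrite -/L -/K -/x.
  set f := flat_weight nu i0 i; set r := 1 / Num.sqrt f.
  have rf : r ^+ 2 = f^-1 by rewrite expr_div_n sqr_sqrtr ?ltW ?f0 // expr1n div1r.
  have r0 : 0 < r by rewrite divr_gt0 // sqrtr_gt0 f0.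
  move=> /andP[xl xu].
  (* With [k <= m%:R * 4], the threshold 1/8 is what brings every phase into the range of
     [sqr_sin_bounds]. *)
  have Kr1 : 2 * (K * r) <= 1.
    have := ell_le _ iP; rewrite -/f -/r => er.
    have : K * r <= m%:R * 4 * (eps * r).
      by rewrite /K -mulrA ler_wpM2r // mulr_ge0 ?ltW.
    lra.
  have /sqr_sin_bounds /andP[sl su] : `|x| <= 1 by exact: le_trans Kr1.
  have Kr0 : 0 < K * r by rewrite mulr_gt0.
  rewrite -rf; rewrite -(real_normK (num_real x)) in sl su.
  have x0 := normr_ge0 x.
  apply/andP; split.
    apply: le_trans sl.
    rewrite (_ : _ * r ^+ 2 = (delta / 2 * (K * r)) ^+ 2 / 4); last by field.
    by rewrite ler_pM2r // ler_sqr ?nnegrE // mulr_ge0 // ?ltW // divr_gt0.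
  apply: (le_trans su).
  rewrite (_ : _ * r ^+ 2 = (2 * (K * r)) ^+ 2); last by ring.
  by rewrite ler_sqr ?nnegrE // mulr_ge0 // ltW.
(* The lower bound in [sinB] is positive, so the sines do not vanish and [star_amplitudes]
   applies. *)
have sinS i : (1 <= i <= n)%N -> 0 < sin (k * L i) ^+ 2.
  move=> iP; have /andP[h _] := sinB _ iP; apply: lt_le_trans h.
  by rewrite !divr_gt0 ?f0 // exprn_gt0 // mulr_gt0.
have [|V V0 VE] := star_amplitudes k0 L0 _ eig.
  by move=> i iP; have := sinS _ iP; rewrite lt0r sqrf_eq0 => /andP[].
(* The central value [V] and the scale [K] cancel in the ratio of the two bounds, leaving 192 = 3 *
   16 * 4; only [delta] remains. *)
have cE : 192 / delta ^+ 2 =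
    3 * (V * 16 / (delta * K) ^+ 2) / (V / (4 * K ^+ 2)).
  by field; rewrite !gt_eqF.
rewrite cE; apply: normalized_weight_bounds.
- by rewrite divr_gt0 // mulr_gt0 // exprn_gt0.
- by rewrite divr_gt0 // ?mulr_gt0 // exprn_gt0 // mulr_gt0.
- move=> i iP; rewrite VE //; have /andP[sl su] := sinB _ iP.
  have fi := f0 _ iP; have si := sinS _ iP; have dK : 0 < delta * K by rewrite mulr_gt0.
  have V0' := ltW V0.
  rewrite ler_pdivlMr // ler_pdivrMr //.
  apply/andP; split.
    rewrite [leRHS](_ : V = V / (4 * K ^+ 2) * flat_weight nu i0 i *
        (4 * K ^+ 2 / flat_weight nu i0 i)); last first.
      by field; rewrite !gt_eqF.
    by rewrite ler_pM2l // mulr_gt0 // divr_gt0 // mulr_gt0 // exprn_gt0.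
  rewrite [leLHS](_ : V = V * 16 / (delta * K) ^+ 2 * flat_weight nu i0 i *
      ((delta * K) ^+ 2 / 16 / flat_weight nu i0 i)); last first.
    by field; rewrite !gt_eqF.
  by rewrite ler_pM2l // mulr_gt0 // divr_gt0 // ?mulr_gt0 // exprn_gt0.
- by move=> i iP; rewrite ltW // f0.
have := @sum_flat_weight nu n i0 (ltnW n2).
by rewrite nuS mulr1; apply=> i /nu0 /andP[h1 ->]; rewrite ltW.
Qed.

End Phases.

(** * Comparison of the power sums entering the mass exponents *)

Section PowerSums.
Variable R : realType.
Implicit Types nu mu : nat -> R.

Lemma power_sum_bounds nu mu n i0 (C q : R) :
  (1 <= n)%N -> 0 < C -> 0 <= q ->
  (forall i, (1 <= i <= n)%N -> 0 < nu i <= nu 1) ->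
  (forall i, (1 <= i <= n)%N ->
    C^-1 * flat_weight nu i0 i <= mu i <= C * flat_weight nu i0 i) ->
  0 < \sum_(1 <= i < n.+1) nu i `^ q /\
  (3 * C `^ q)^-1 * \sum_(1 <= i < n.+1) nu i `^ q
    <= \sum_(1 <= i < n.+1) mu i `^ q
    <= 3 * C `^ q * \sum_(1 <= i < n.+1) nu i `^ q.
Proof.
move=> n1 C0 q0 nuP muP.
have nu1 : 0 < nu 1 by have /andP[] := nuP 1%N n1.
have Cq0 : 0 < C `^ q by rewrite powR_gt0.
have f0 i : (1 <= i <= n)%N -> 0 < flat_weight nu i0 i.
  by move=> iP; rewrite /flat_weight; case: ifP => // _; have /andP[] := nuP i iP.
have fq i : flat_weight (fun j => nu j `^ q) i0 i = flat_weight nu i0 i `^ q.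
  by rewrite /flat_weight; case: ifP.
have U0 : 0 < \sum_(1 <= i < n.+1) nu i `^ q.
  rewrite big_ltn // ltr_pwDl ?powR_gt0 // sumr_ge0 // => i _; exact: powR_ge0.
have /andP[Sl Su] := @sum_flat_weight _ (fun i => nu i `^ q) n i0 n1 (fun i iP =>
  introT andP (conj (powR_ge0 _ _)
    (ge0_ler_powR q0 (ltW (andP (nuP i iP)).1) (ltW nu1) (andP (nuP i iP)).2))).
split=> //.
have CV : C^-1 `^ q = (C `^ q)^-1.
  by rewrite -powR_inv1 ?ltW // powRAC powR_inv1 // powR_ge0.
have lb : (C `^ q)^-1 * \sum_(1 <= i < n.+1) flat_weight (fun j => nu j `^ q) i0 i
    <= \sum_(1 <= i < n.+1) mu i `^ q.
  rewrite mulr_sumr big_nat [leRHS]big_nat; apply: ler_sum => i iP.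
  have /andP[h _] := muP i iP; have fi := f0 _ iP.
  have Cf : 0 < C^-1 * flat_weight nu i0 i by rewrite mulr_gt0 ?invr_gt0.
  rewrite fq -CV -powRM ?invr_ge0 ?(ltW C0) ?(ltW fi) //.
  by apply: ge0_ler_powR; rewrite ?nnegrE ?(ltW Cf) // ltW // (lt_le_trans Cf).
have ub : \sum_(1 <= i < n.+1) mu i `^ q <=
    C `^ q * \sum_(1 <= i < n.+1) flat_weight (fun j => nu j `^ q) i0 i.
  rewrite mulr_sumr big_nat [leRHS]big_nat; apply: ler_sum => i iP.
  have /andP[h h'] := muP i iP; have fi := f0 _ iP.
  have Cf : 0 < C^-1 * flat_weight nu i0 i by rewrite mulr_gt0 ?invr_gt0.
  have mu0 := lt_le_trans Cf h.
  rewrite fq -powRM ?(ltW C0) ?(ltW fi) //.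
  by apply: ge0_ler_powR; rewrite ?nnegrE ?(ltW mu0) // ltW // (lt_le_trans mu0).
apply/andP; split.
  apply: le_trans lb; rewrite invfM -mulrA.
  have := ler_wpM2l (ltW (_ : 0 < (C `^ q)^-1)) Sl; rewrite invr_gt0 => /(_ Cq0).
  have : 0 < (C `^ q)^-1 * \sum_(1 <= i < n.+1) nu i `^ q.
    by rewrite mulr_gt0 // invr_gt0.
  lra.
apply: (le_trans ub); rewrite -mulrA mulrCA ler_pM2l //.
Qed.

End PowerSums.

(** * Uniform mass bounds for large [n] and equality of the mass exponents *)

Unset Implicit Arguments.

Theorem theorem1p5 (R : realType) (nu : nat -> nat -> R) (i0 : nat -> nat)
    (eps : nat -> R) (alpha : R) (k : nat -> R) (m : nat -> nat) (delta : R)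
    (L := fun n => edge_length (nu n) (i0 n) (eps n))
    (p := fun n i => (m n)%:R * pi / L n i)
    (nu_prob : forall n, (2 <= n)%N -> is_probability n (nu n))
    (nu_gt0 : forall n, (2 <= n)%N ->
       forall i, (1 <= i <= n)%N -> 0 < nu n i)
    (nu_decr : forall n, (2 <= n)%N ->
       forall i, (1 <= i <= n - 1)%N -> nu n i.+1 < nu n i)
    (i0_bounds : forall n, (2 <= n)%N -> (1 <= i0 n <= n - 1)%N)
    (eps_gt0 : forall n, (2 <= n)%N -> 0 < eps n)
    (L_gt0 : forall n, (2 <= n)%N ->
       forall i, (1 <= i <= n)%N -> 0 < L n i)
    (k_gt0 : forall n, (2 <= n)%N -> 0 < k n)
    (k_eigenvalue : forall n, (2 <= n)%N ->
       star_eigenvalue n (L n) alpha (k n ^+ 2))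
    (k_infty : k n @[n --> \oo] --> +oo)
    (m_ge1 : forall n, (2 <= n)%N -> (1 <= m n)%N)
    (k_between : forall n, (2 <= n)%N ->
       p n (i0 n).+1 < k n < p n (i0 n))
    (delta_bounds : 0 < delta <= 1 / 2)
    (repulsion : forall n, (2 <= n)%N ->
       delta <= Num.min `|k n - p n (i0 n)| `|k n - p n (i0 n).+1|
                / `|p n (i0 n) - p n (i0 n).+1|)
    (clustering : (m n)%:R * eps n * sup_norm n (edge_ell (nu n) (i0 n))
                    @[n --> \oo] --> (0 : R)) :
  (exists C : R, 1 <= C /\
     \forall n \near \oo, forall phi : nat -> R -> complex R,
       star_eigenfunction n (L n) alpha (k n ^+ 2) phi ->
       forall i, (1 <= i <= n)%N -> i != i0 n -> i != (i0 n).+1 ->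
         C^-1 * nu n i <= mass_measure n (L n) (k n) phi i <= C * nu n i) /\
  (forall phi : nat -> nat -> R -> complex R,
     (forall n, (2 <= n)%N ->
        star_eigenfunction n (L n) alpha (k n ^+ 2) (phi n)) ->
     forall q : R, 1 <= q ->
       mass_exponent nu q =
       mass_exponent (fun n => mass_measure n (L n) (k n) (phi n)) q).
Proof.
have nuP n : (2 <= n)%N -> forall i, (1 <= i <= n)%N -> 0 < nu n i <= nu n 1%N.
  move=> n2 i iP; rewrite nu_gt0 //=.
  elim: i iP => [//|[//|i] IH] iP.
  by apply: le_trans (IH _); [apply/ltW/nu_decr => //; lia|lia].
have d0 : 0 < delta by case/andP: delta_bounds.
set C := 192 / delta ^+ 2.
have C1 : 1 <= C.
  have /andP[_ d1] := delta_bounds.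
  by rewrite ler_pdivlMr ?exprn_gt0 // mul1r; nra.
have C0 : 0 < C := lt_le_trans ltr01 C1.
(* The quantifier over [phi] stands after the choice of the threshold for [n], which thus serves all
   eigenfunctions at once. The bounds include the two special edges, as the power sums require. *)
have bounds : \forall n \near \oo, (2 <= n)%N /\ forall phi : nat -> R -> complex R,
    star_eigenfunction n (L n) alpha (k n ^+ 2) phi ->
    forall i, (1 <= i <= n)%N ->
      C^-1 * flat_weight (nu n) (i0 n) i <= mass_measure n (L n) (k n) phi i
        <= C * flat_weight (nu n) (i0 n) i.
  have small : \forall n \near \oo,
      (m n)%:R * eps n * sup_norm n (edge_ell (nu n) (i0 n)) <= 1 / 8.
    have e0 : (0 : R) < 1 / 8 by rewrite divr_gt0.
    move/cvgrPdist_le : clustering => /(_ _ e0); apply: filterS => n.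
    by rewrite sub0r normrN => /(le_trans (ler_norm _)).
  have n2 : \forall n \near \oo, (2 <= n)%N by exact: nbhs_infty_ge.
  apply: filterS2 small n2 => n small n2; split=> // phi eig.
  exact: mass_measure_bounds (nu_prob _ n2) (nuP _ n2) (i0_bounds _ n2)
    (eps_gt0 _ n2) (L_gt0 _ n2) (k_gt0 _ n2) (m_ge1 _ n2) (k_between _ n2)
    delta_bounds (repulsion _ n2) small eig.
split.
  exists C; split=> //; apply: filterS bounds => n [_ bounds] phi eig i iP ii0 ii1.
  have := bounds _ eig _ iP.
  by rewrite /flat_weight (negbTE ii0) (negbTE ii1).
(* The comparison constant depends on [q] but not on [n], so it disappears in the upper limit. *)
move=> phi eig q q1; apply: (@eq_limn_esup_ln_ratio _ _ _ (3 * C `^ q)).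
  apply: filterS bounds => n [n2 bounds].
  apply: (@power_sum_bounds _ _ _ _ (i0 n)) => //.
  - exact: ltnW.
  - exact: le_trans q1.
  - exact: nuP.
  - exact: bounds (eig _ n2).
by rewrite mulr_gt0 // powR_gt0.
Qed.
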